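(* Let $d,k \in \mathbb{N}$, let $\Gamma$ be an abelian group, let $\pi:\mathbb{Z}^d \to \Gamma$ be a surjective group homomorphism, and let $D \subseteq \mathbb{Z}^d$ be a fundamental domain for $\ker(\pi)$. Then there exist $N \in \mathbb{N}$ and finite subsets $T_1,\ldots,T_{2k} \subset \mathbb{Z}^d$ such that for all finite subsets $F_1,\ldots,F_k$ of $\Gamma$ with $0 \in F_j$ for all $1\le j\le k$, we have $$\mathit{Tile}_0(\tilde F_1,\ldots,\tilde F_k;\mathbb{Z}^d) = N\Big((\pi^{\otimes k})^{-1}\mathit{Tile}_0(F_1,\ldots,F_k;\Gamma)\Big),$$ where for $1\le j\le k$ $$\tilde F_j := \Big(N\big(\pi^{-1}(F_j\setminus\{0\})\cap D\big)\oplus T_j\Big)\uplus T_{k+j}\ \subset \mathbb{Z}^d$$ (in particular, the sum is direct and the union is disjoint). Here the right-hand side of the displayed identity is $$N\Big((\pi^{\otimes k})^{-1}\mathit{Tile}_0(F_1,\ldots,F_k;\Gamma)\Big)=\big\{(N\pi^{-1}(A_1),\ldots,N\pi^{-1}(A_k)) : (A_1,\ldots,A_k)\in \mathit{Tile}_0(F_1,\ldots,F_k;\Gamma)\big\}.$$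
   Context: $\mathbb{N}$ denotes the positive integers. For an abelian group $\Gamma$ and subsets $A,B,C\subseteq\Gamma$, $A\oplus B=C$ means that $A+B=C$ and every $c\in C$ has a unique representation $c=a+b$ with $a\in A$, $b\in B$ (so writing $A\oplus B$ asserts that the sum is direct). $\biguplus_{i\in I}A_i$ denotes the union of pairwise disjoint sets (so writing it asserts disjointness), and $\uplus$ is its binary version. For $N\in\mathbb{N}$ and $A\subseteq\mathbb{Z}^d$, $NA:=\{Nv: v\in A\}$. For a subgroup $L<\Gamma$, a set $D\subseteq\Gamma$ is a fundamental domain for $L$ if it contains exactly one representative of each coset of $L$, equivalently $D\oplus L=\Gamma$. For finite subsets $F_1,\ldots,F_k\subset\Gamma$ and $E\subseteq\Gamma$, $$\mathit{Tile}(F_1,\ldots,F_k;E)=\Big\{(A_1,\ldots,A_k)\in(2^\Gamma)^k:\ \biguplus_{j=1}^k(F_j\oplus A_j)=E\Big\},$$ $$\mathit{Tile}_0(F_1,\ldots,F_k;E)=\Big\{(A_1,\ldots,A_k)\in\mathit{Tile}(F_1,\ldots,F_k;E):\ 0\in\biguplus_{j=1}^kA_j\Big\},$$ where $2^\Gamma$ is the set of all subsets of $\Gamma$. *)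

(* Defs.v *)
From HB Require Import structures.
From mathcomp Require Import all_boot all_order all_algebra.
From mathcomp Require Import all_classical.

Set Implicit Arguments.
Unset Strict Implicit.
Unset Printing Implicit Defensive.

Import GRing.Theory.
Local Open Scope classical_set_scope.
Local Open Scope ring_scope.

Section Sets.
Variable G : zmodType.
Implicit Types (A B L D E : set G) (N : nat).

Definition sumset A B : set G := [set a + b | a in A & b in B].

(* The sum A + B is direct, i.e. writing it as A (+) B is legitimate. *)
Definition direct A B : Prop :=
  forall c, sumset A B c ->
    exists! p : G * G, [/\ A p.1, B p.2 & c = p.1 + p.2].

Definition dilate N A : set G := [set v *+ N | v in A].

Definition coset_of_subgroup L (x : G) : set G := [set x + l | l in L].

Definition fundamental_domain L D : Prop :=
  forall x, exists! y, (D `&` coset_of_subgroup L x) y.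

(* The disjoint-union notation in the mathematical definition asserts pairwise
   disjointness, whence the trivIset conditions here and in Tile0. *)
Definition Tile k (F : 'I_k -> set G) E : set ('I_k -> set G) :=
  [set A | [/\ forall j, direct (F j) (A j),
               trivIset [set: 'I_k] (fun j => sumset (F j) (A j)) &
               \bigcup_(j in [set: 'I_k]) sumset (F j) (A j) = E]].

Definition Tile0 k (F : 'I_k -> set G) E : set ('I_k -> set G) :=
  [set A | [/\ Tile F E A,
               trivIset [set: 'I_k] A &
               (\bigcup_(j in [set: 'I_k]) A j) 0]].

End Sets.

Section Lift.
Variables (d : nat) (Gamma : zmodType) (pi : {additive 'rV[int]_d -> Gamma}).
Variables (D : set 'rV[int]_d) (N k : nat).

Definition kernel : set 'rV[int]_d := pi @^-1` [set 0].

Definition lifted_part (F : set Gamma) : set 'rV[int]_d :=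
  dilate N (pi @^-1` (F `\ 0) `&` D).

(* T_1, ..., T_k are the T (lshift k j) and T_(k+1), ..., T_(2k) are the
   T (rshift k j), for j : 'I_k. *)
Definition lifted_tile (T : 'I_(k + k) -> set 'rV[int]_d)
    (F : 'I_k -> set Gamma) (j : 'I_k) : set 'rV[int]_d :=
  sumset (lifted_part (F j)) (T (lshift k j)) `|` T (rshift k j).

Definition lifted_tilings (S : set ('I_k -> set Gamma)) :
    set ('I_k -> set 'rV[int]_d) :=
  [set (fun j => dilate N (pi @^-1` (A j))) | A in S].

End Lift.

(* Main.v *)
Require Import Defs.
From HB Require Import structures.
From mathcomp Require Import all_boot all_order all_algebra.
From mathcomp Require Import all_classical.
From mathcomp Require Import zify.

(** Write V for Z^d and K for the kernel of pi.  The integer N is a large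
multiple of 4, and each of the 2k sets T_i is the cube [0, N)^d with some of its
points r displaced by N times a vector c_i(r); thus T_i meets every residue
class modulo N exactly once.  A tiling of V by translates of the lifted tiles is
a tiling by translates of the pieces T_i, and the displaced points constrain it
in two ways.

- Rigidity.  For each axis l, every T_i has the same point notch l displaced by
  N e_l, which digs a hole in the cube and puts a point outside it.  The hole
  is one unit wide along axis 0, whereas every point of a piece other
  than a displaced notch has a neighbour along axis 0 in that piece
  (shift_neighbour); hence the hole of a piece at x is filled by a displaced
  notch l' of a piece at some x'.  If l and l' differ, the cubes at x and x'
  overlap, which is impossible (box_overlap).  So l = l' and x' = x - N e_l
  (notch_filled).  Moving any two pieces down by multiples of N along the axes
  brings their difference into the cube, where it has to vanish: all pieces lie
  in a single class modulo N (piece_rigid).  As one of them lies at 0, the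
  positions are N w for w in V, and each w carries exactly one piece.

- Kernel invariance.  K is finitely generated (subgroup_finite_generators).
  For each generator g and each j, the piece T_(k+j), and no other, has a point
  of its own residue class displaced by N g.  The hole left at w can only be
  filled by a piece T_(k+j) at w - g, and the point put at w + g leaves room only
  for a piece T_(k+j) there.  So the positions of T_(k+j) are invariant under g
  and - g, hence under K (kernel_stable).

A piece T_(k+j) marks a position of the lifted j-th tile, so these positions
form N times a K-invariant set, that is N pi^-1(A_j); looking at the corner of
each cube, one reads off that the A_j tile Gamma.  Conversely, pi(c_i(r)) does
not depend on i, since it is pi(e_l) or 0.  Therefore, over a residue class r, a
tiling of Gamma lifts to a tiling of the points of V congruent to r, the choice
of piece being absorbed by K (dilate_preimage_tiling). *)

Set Implicit Arguments.
Unset Strict Implicit.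
Unset Printing Implicit Defensive.

Import Order.TTheory GRing.Theory Num.Theory.
Local Open Scope classical_set_scope.
Local Open Scope ring_scope.

(** * Subgroups of Z^d are finitely generated *)

(** Generation is expressed as an induction principle, the form in which it
propagates invariance from the generators to the whole subgroup.  The
generators form an echelon basis: one vector with the least positive value of
the last coordinate on which the subgroup is not zero, then generators of the
elements that vanish there. *)
Lemma subgroup_finite_generators d (L : set 'rV[int]_d) :
  L 0 -> (forall u v, L u -> L v -> L (u - v)) ->
  exists gs : seq 'rV[int]_d, (forall g, g \in gs -> L g) /\
    forall P : set 'rV[int]_d, P 0 ->
      (forall g v, g \in gs -> P v -> P (v + g) /\ P (v - g)) -> L `<=` P.
Proof.
suff H n : forall L : set 'rV[int]_d, L 0 ->
    (forall u v, L u -> L v -> L (u - v)) ->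
    (forall v (i : 'I_d), L v -> (n <= i)%N -> v 0 i = 0) ->
    exists gs : seq 'rV[int]_d, (forall g, g \in gs -> L g) /\
      forall P : set 'rV[int]_d, P 0 ->
        (forall g v, g \in gs -> P v -> P (v + g) /\ P (v - g)) -> L `<=` P.
  by move=> L0 LB; apply: (H d) => // v i _; rewrite leqNgt ltn_ord.
elim: n => [|n IHn] {}L L0 LB Ln.
  exists [::]; split=> // P P0 _ v Lv.
  suff -> : v = 0 by [].
  by apply/rowP => i; rewrite mxE; apply: Ln.
have LN u : L u -> L (- u) by move=> Lu; rewrite -sub0r; apply: LB.
have LD u v : L u -> L v -> L (u + v).
  by move=> Lu Lv; rewrite -[v]opprK; apply: LB => //; apply: LN.
have [[i [in_ [g0 [Lg0 g0i]]]]|flat] :=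
    pselect (exists i : 'I_d, i = n :> nat /\ exists g, L g /\ g 0 i != 0);
  last first.
  apply: IHn => // v i Lv; rewrite leq_eqVlt => /orP[/eqP ni|/(Ln _ _ Lv)//].
  apply: contrapT => vi; apply: flat; exists i; split => //.
  by exists v; split => //; apply/eqP.
pose isval m := `[< exists g, L g /\ g 0 i = (m.+1)%:Z >].
have exm : exists m, isval m.
  exists (absz (g0 0%R i)).-1; apply/asboolP.
  have [g0_gt0|g0_le0] := ltP 0 (g0 0 i); first by exists g0; split => //; lia.
  exists (- g0); split; first exact: LN.
  by rewrite mxE; move: (g0 0 i) g0i g0_le0 => z; lia.
case: (ex_minnP exm) => m /asboolP[g [Lg gi]] min_m.
have LZ (q : nat) : L (g *+ q).
  by elim: q => [|q IHq]; rewrite ?mulr0n // mulrS; apply: LD.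
have LZz (q : int) : L (g *~ q) by case: q => q; [apply: LZ | apply/LN/LZ].
have [|||gs [gsL gsP]] := IHn [set v | L v /\ v 0 i = 0].
- by split => //; rewrite mxE.
- by move=> u v [Lu ui] [Lv vi]; split; [apply: LB | rewrite !mxE ui vi].
- move=> v i' [Lv vi]; rewrite leq_eqVlt => /orP[/eqP ni|/(Ln _ _ Lv)//].
  by have -> : i' = i by apply: val_inj; rewrite /= in_.
exists (g :: gs); split=> [h|P P0 Pgs v Lv].
  by rewrite inE => /predU1P[->//|/gsL[]].
pose q := (v 0%R i %/ m.+1)%Z.
have gqi : (g *~ q) 0 i = q * m.+1%:Z.
  suff gmul (z : int) : (g *~ z) 0 i = g 0 i * z by rewrite gmul gi mulrC.
  by rewrite -scaler_int mxE intz mulrC.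
(* Minimality of the pivot kills the remainder of the division. *)
have rem0 : (v - g *~ q) 0 i = 0.
  have v_eq := divz_eq (v 0 i) m.+1.
  have v_ge := modz_ge0 (v 0 i) (isT : m.+1%:Z != 0).
  have v_lt := ltz_pmod (v 0 i) (isT : 0 < m.+1%:Z).
  have rE : (v - g *~ q) 0 i = (v 0%R i %% m.+1)%Z.
    by rewrite !mxE gqi /q {1}v_eq addrAC subrr add0r.
  rewrite rE; apply: contrapT => r0.
  have : isval (absz (v 0%R i %% m.+1)%Z).-1.
    by apply/asboolP; exists (v - g *~ q); split; [apply: LB | rewrite rE; lia].
  by move=> /min_m; lia.
have Pr : P (v - g *~ q).
  apply: (gsP P) => //; first by move=> h u hgs; apply: Pgs; rewrite inE hgs orbT.
  by split => //; apply: LB.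
have Pgq (z : nat) u : P u -> P (u + g *+ z) /\ P (u - g *+ z).
  have ging : g \in g :: gs by rewrite mem_head.
  move=> Pu; elim: z => [|z [IH1 IH2]]; first by rewrite mulr0n subr0 addr0.
  rewrite mulrSr opprD !addrA.
  by split; [have [] := Pgs _ _ ging IH1 | have [] := Pgs _ _ ging IH2].
rewrite -[v](subrK (g *~ q)).
by case: (q) Pr => z /(Pgq _)/=; [move=> /(_ z)[] | rewrite NegzE => /(_ z.+1)[]].
Qed.

(** * The cube of residues and the pieces *)

Section Box.
Variables (d N : nat).
Implicit Types r w z : 'rV[int]_d.

Definition box : set 'rV[int]_d := [set r | forall l, 0 <= r 0 l < N%:Z].

Lemma box_euclid z : (0 < N)%N -> exists w r, box r /\ z = r + w *+ N.
Proof.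
move=> N_gt0; have N_neq0 : N%:Z != 0 by lia.
exists (\row_l (z 0%R l %/ N)%Z), (\row_l (z 0%R l %% N)%Z); split=> [l|].
  by rewrite mxE modz_ge0 //= ltz_pmod.
by apply/rowP => l; rewrite mxE mulmxnE !mxE -mulr_natr natz addrC -divz_eq.
Qed.

Lemma box_inj r r' w w' :
  box r -> box r' -> r + w *+ N = r' + w' *+ N -> r = r' /\ w = w'.
Proof.
move=> br br' E.
have El l : r 0 l = r' 0 l /\ w 0 l = w' 0 l.
  have /rowP/(_ l) := E; rewrite !mxE !mulmxnE.
  rewrite -[w 0 l *+ N]mulr_natr -[w' 0 l *+ N]mulr_natr !natz.
  have := br l; have := br' l.
  move: (r 0 l) (r' 0 l) (w 0 l) (w' 0 l) => a a' b b' ra' ra {}E.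
  have far c c' : c < c' -> N%:Z <= (c' - c) * N%:Z.
    by move=> lt_c; rewrite ler_peMl //; lia.
  by case: (ltrgtP b b') => [/far|/far|bb']; lia.
by split; apply/rowP => l; have [] := El l.
Qed.

Lemma finite_box : finite_set box.
Proof.
pose f (u : {ffun 'I_d -> 'I_N}) : 'rV[int]_d := \row_l (u l)%:Z.
apply: (@sub_finite_set _ _ (f @` [set: {ffun 'I_d -> 'I_N}])); last first.
  exact: finite_image.
move=> r br; have lt_rN l : (absz (r 0%R l) < N)%N by have := br l; lia.
exists [ffun l => Ordinal (lt_rN l)] => //.
by apply/rowP => l; rewrite mxE ffunE /=; have := br l; lia.
Qed.

End Box.

Section Shift.
Variables (d k : nat) (gs : seq 'rV[int]_d.+1).
Notation V := 'rV[int]_d.+1.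
Implicit Types (i : 'I_(k + k)) (r w z : V) (l : 'I_d.+1).

(** At least 3, so that slabs 0, 1 and 2, which contain the notches and their
neighbours, remain free of generators: these use the slabs from width on. *)
Definition width := (size gs).+3.

(** Twice the first coordinate at which slabs stop carrying generators, so that
the upper half of the cube is intact. *)
Definition period := (4 * (width * k.+1))%N.
Notation N := period.

Definition basis l : V := delta_mx 0 l.
Definition notch l : V := const_mx 3 - basis l.
Definition col r : nat := absz (r 0%R 0%R).

(** The displacement of the points with first coordinate u that are not notches.
Slabs have thickness two, so that displacing one as a whole isolates no point.
The quotient of the slab number by the width selects j, the remainder selects
the generator; beyond the length of gs the default 0 leaves the slab in place. *)
Definition slab i (u : nat) : V :=
  if fintype.split i is inr j then
    if (u./2 %/ width == j.+1)%N then gs`_(u./2 %% width) else 0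
  else 0.

Definition shift i r : V :=
  if [pick l | r == notch l] is Some l then basis l else slab i (col r).

Definition place i r : V := r + shift i r *+ N.

(** The T_i: the pieces T_1, ..., T_k are indexed by lshift, and only the pieces
T_(k+1), ..., T_(2k), indexed by rshift, carry generators. *)
Definition tile i : set V := place i @` box N.

Lemma period_gt0 : (0 < N)%N. Proof. by rewrite /period /width; lia. Qed.

Lemma box0 : box N (0 : V).
Proof. by move=> l; rewrite mxE lexx ltz_nat period_gt0. Qed.

Lemma place_id i r : shift i r = 0 -> place i r = r.
Proof. by rewrite /place => ->; rewrite mul0rn addr0. Qed.

Lemma notch_inj : injective notch.
Proof.
move=> l l' /addrI/oppr_inj/rowP/(_ l); rewrite !mxE !eqxx /=.
by case: eqP.
Qed.

Lemma shift_notch i l : shift i (notch l) = basis l.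
Proof.
rewrite /shift; case: pickP => [l' /eqP/notch_inj->//|/(_ l)].
by rewrite eqxx.
Qed.

Lemma shift_slab i r : (forall l, r <> notch l) -> shift i r = slab i (col r).
Proof. by move=> nr; rewrite /shift; case: pickP => [l /eqP/nr|]. Qed.

Lemma notch_col l : col (notch l) \in [:: 2; 3]%N.
Proof. by rewrite /col !mxE eqxx /=; case: eqP. Qed.

Lemma box_notch l : box N (notch l).
Proof.
have N4 : (4 <= N)%N by rewrite /period /width; lia.
by move=> l'; rewrite !mxE; case: eqP => _ /=; lia.
Qed.

Lemma shift_col i r : col r \notin [:: 2; 3]%N -> shift i r = slab i (col r).
Proof.
by move=> cr; apply: shift_slab => l rE; rewrite rE notch_col in cr.
Qed.

Lemma slab_low i u : (u < 6)%N -> slab i u = 0.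
Proof.
rewrite /slab; case: (fintype.split i) => // j u6.
by rewrite divn_small // /width; lia.
Qed.

Lemma shift0 i : shift i 0 = 0.
Proof. by rewrite shift_col /col mxE // slab_low. Qed.

Lemma slab_high i u : (2 * (width * k.+1) <= u)%N -> slab i u = 0.
Proof.
rewrite /slab; case: (fintype.split i) => // j hu; case: eqP => // E.
have : (k.+1 <= u./2 %/ width)%N
  by rewrite leq_divRL // mulnC; move: (width * _)%N hu => M; lia.
by rewrite E => /leq_trans/(_ (ltn_ord j)); rewrite ltnn.
Qed.

Lemma slab_half i u v : u./2 = v./2 -> slab i u = slab i v.
Proof. by rewrite /slab => ->. Qed.

(** The corner of the slab that the piece rshift k j displaces by g. *)
Definition socket (j : 'I_k) (g : V) : V :=
  (2 * (width * j.+1 + index g gs))%:Z *: basis 0.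

Lemma socket_col j g : col (socket j g) = (2 * (width * j.+1 + index g gs))%N.
Proof. by rewrite /col !mxE /= muln1. Qed.

Lemma box_socket j g : g \in gs -> box N (socket j g).
Proof.
rewrite -index_mem => lt_g l.
have lt_w : (width * j.+1 + index g gs < width * k.+1)%N.
  apply: (@leq_trans (width * j.+2)); last by rewrite leq_mul2l; have := ltn_ord j; lia.
  by rewrite [leqRHS]mulnS addnC ltn_add2r (leq_trans lt_g) // !leqW.
have -> : socket j g 0 l = if l == 0 then (2 * (width * j.+1 + index g gs))%:Z else 0.
  by rewrite !mxE /=; case: (l == 0); rewrite ?mulr1 ?mulr0.
move: lt_w; rewrite /period; move: (width * k.+1)%N (width * _ + _)%N => M M' lt_M.
by case: eqP => _; lia.
Qed.

Lemma shift_socket i j g : g \in gs ->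
  shift i (socket j g) = if i == rshift k j then g else 0.
Proof.
move=> ging; have lt_g : (index g gs < width)%N.
  by rewrite !leqW // index_mem.
rewrite shift_col ?socket_col; last first.
  by rewrite !inE; apply/norP; split; rewrite /width; lia.
rewrite /slab mul2n doubleK mulnC divnMDl // modnMDl divn_small // addn0.
rewrite modn_small // nth_index //.
case: (split_ordP i) => j' ->; first by rewrite eq_lrshift.
by rewrite eq_rshift (inj_eq succn_inj) (inj_eq val_inj) eq_sym.
Qed.

(** The displacements at r are equal or are all generators and zeros; this is
why, after applying f, the pieces become interchangeable. *)
Lemma shift_morphism (G : zmodType) (f : {additive V -> G}) i i' r :
  (forall g, g \in gs -> f g = 0) -> f (shift i r) = f (shift i' r).
Proof.
move=> fgs; rewrite /shift; case: pickP => [l _|_] //.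
have f0 i0 u : f (slab i0 u) = 0.
  rewrite /slab; case: (fintype.split i0) => [j|j]; rewrite ?raddf0 //.
  case: ifP => _; rewrite ?raddf0 //.
  have [lt_u|le_u] := ltnP (u./2 %% width) (size gs).
    exact/fgs/mem_nth.
  by rewrite nth_default ?raddf0.
by rewrite !f0.
Qed.

(** Points other than notches are never isolated along axis 0, because slabs are
two points thick. *)
Lemma shift_neighbour r : box N r -> (forall l, r <> notch l) ->
  exists2 s : int, s = 1 \/ s = -1 &
    box N (r + s *: basis 0) /\ forall i, shift i (r + s *: basis 0) = shift i r.
Proof.
move=> br nr.
(* The partner of r in its slab, except at coordinates 2 and 3: a partner there
   could be a notch, so 2 goes to 1 and 3 to 4. *)
pose down := odd (col r) (+) (col r \in [:: 2; 3])%N.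
pose s : int := if down then -1 else 1.
pose r' := r + s *: basis 0; exists s.
  by rewrite /s; case: ifP; [right|left].
rewrite -/r'.
have r0 : r 0 0 = (col r)%:Z by have := br 0; rewrite /col; lia.
have r'0 : r' 0 0 = (col r)%:Z + s by rewrite !mxE /= mulr1 r0.
have br0 := br 0.
have colr' : [/\ 0 <= r' 0 0 < N%:Z, col r' \notin [:: 2; 3]%N &
    (col r < 6)%N /\ (col r' < 6)%N \/ (col r)./2 = (col r')./2].
  have N8 : (8 <= N)%N by rewrite /period /width; lia.
  have Nodd : odd N = false by rewrite /period oddM.
  rewrite /col r'0 -/(col r) /s /down; move: br0; rewrite r0.
  move: (col r) (period) N8 Nodd => c M M8 Modd cM; rewrite !inE.
  have [c4|c4] := ltnP c 4.
    by case: c c4 {cM} => [|[|[|[|]]]] //= _; split; try lia; left; lia.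
  have -> : ((c == 2) || (c == 3))%N = false by lia.
  by case: (boolP (odd c)) => oc /=; split; try lia; right; lia.
case: colr' => br'0 nr' E; split.
- move=> l; have := br l; have [->//|/negPf nl] := eqVneq l 0.
  by rewrite !mxE /= nl /= mulr0 addr0.
- move=> i; rewrite shift_col // (shift_slab _ nr).
  case: E => [[lo lo']|E]; first by rewrite !slab_low.
  exact: slab_half.
Qed.

(** A notch has the width of one point along axis 0: both of its neighbours stay
in the cube. *)
Lemma notch_neighbour l s i : s = 1 \/ s = -1 ->
  box N (notch l + s *: basis 0) /\ shift i (notch l + s *: basis 0) = 0.
Proof.
move=> hs.
have N5 : (5 <= N)%N by rewrite /period /width; lia.
split.
  move=> l'; rewrite !mxE; case: hs => ->; case: eqP => _; case: eqP => _ /=; lia.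
rewrite shift_slab.
  rewrite slab_low // /col !mxE; case: hs => ->; case: eqP => _ /=; lia.
move=> l' /rowP E; have := (E 0, E l, E l'); rewrite !mxE /= !eqxx /=.
rewrite ![0 == _]eq_sym [l' == l]eq_sym.
by case: hs => ->; case: (l == 0); case: (l' == 0); case: (l == l') => /= -[[]]; lia.
Qed.

End Shift.

(** * Rigidity of tilings by the pieces *)

Section Pieces.
Variables (d k : nat) (gs : seq 'rV[int]_d.+1).
Notation V := 'rV[int]_d.+1.
Notation N := (period k gs).
Notation shift := (@shift d k gs).
Notation place := (@place d k gs).
Implicit Types (X : 'I_(k + k) -> set V) (i : 'I_(k + k)) (x r w z : V).

Definition piece_tiling X : Prop :=
  (forall z, exists i x r, [/\ X i x, box N r & z = x + place i r]) /\
  (forall i i' x x' r r', X i x -> X i' x' -> box N r -> box N r' ->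
     x + place i r = x' + place i' r' -> i = i' /\ x = x').

Variable X : 'I_(k + k) -> set V.
Hypothesis tX : piece_tiling X.

(** Two cubes whose offset is a nonzero residue would share the corner of one of
them.  If the lower corner of x is a displaced point of the cube at x', then the
offset is in the lower half along axis 0, so the top corner of x' corresponds to
a point in the upper half of the cube at x, which is not displaced. *)
Lemma box_overlap i i' x x' :
  X i x -> X i' x' -> box N (x - x') -> x = x'.
Proof.
have [_ uX] := tX; move=> Xx Xx' bxx'.
have [c0|c0] := eqVneq (shift i' (x - x')) 0.
  have [] // := uX _ _ _ _ _ _ Xx Xx' (box0 k gs) bxx'.
  by rewrite !place_id ?shift0 // addr0 subrKC.
pose top : V := const_mx (N%:Z - 1).
pose H := (2 * (width gs * k.+1))%N.
have NH : N = (2 * H)%N by rewrite /period /H; lia.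
have H4 : (4 <= H)%N by rewrite /H /width; lia.
have col_high i0 r : (H <= col r)%N -> shift i0 r = 0.
  move=> hr; rewrite shift_col ?slab_high // !inE.
  by apply/norP; split; lia.
have lowx : (col (x - x') < H)%N.
  by rewrite ltnNge; apply: contra c0 => /col_high ->.
have btop : box N top by move=> l; rewrite mxE; lia.
have topE r l : (top - r) 0 l = N%:Z - 1 - r 0 l by rewrite !mxE.
have bdiff : box N (top - (x - x')).
  by move=> l; have := bxx' l; rewrite topE; lia.
have [] // := uX _ _ _ _ _ _ Xx Xx' bdiff btop.
have bl := bxx' 0.
rewrite !place_id ?col_high //; last 2 first.
- by rewrite /col mxE; lia.
- by move: lowx; rewrite /col topE; lia.
by rewrite opprB addrCA subrKC addrC.
Qed.

(** The hole at notch l of the piece at x is filled by a displaced notch l' of a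
piece at x', since any other point would bring along a neighbour already covered
by x.  For l' different from l the offset x - x' is e_l + (N - 1) e_l', which is
a residue and is excluded by box_overlap. *)
Lemma notch_filled i x l : X i x -> exists i', X i' (x - basis l *+ N).
Proof.
have [cX uX] := tX; move=> Xx.
have [i' [x' [r' [Xx' br' E]]]] := cX (x + notch l).
have [[l' r'E]|nr'] := pselect (exists l', r' = notch l').
  have dxx' : x - x' = basis l - basis l' + basis l' *+ N.
    apply/rowP => l0; move/rowP/(_ l0): E; rewrite r'E /place shift_notch /notch.
    move: (basis l) (basis l') => e e'; rewrite !mxE !mulmxnE.
    by move: (x 0 l0) (x' 0 l0) (e 0 l0) (e' 0 l0) => a a' b b'; lia.
  have [ll'|ll'] := eqVneq l l'.
    exists i'; rewrite (_ : x - _ = x') //.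
    by rewrite -[x](subrK x') dxx' ll' subrr add0r addrAC subrr add0r.
  suff xx' : x = x'.
    have /rowP/(_ l) := dxx'; rewrite xx' subrr !mxE mulmxnE !mxE /= eqxx.
    by rewrite (negbTE ll') mul0rn.
  apply: (box_overlap Xx Xx') => l0; rewrite dxx' !mxE mulmxnE !mxE /=.
  have N_gt0 := period_gt0 k gs.
  have [->|_] := eqVneq l0 l; first by rewrite (negbTE ll') mul0rn /period /width; lia.
  by case: (l0 == l'); rewrite ?mul0rn; lia.
have {}nr' l' : r' <> notch l' by move=> r'E; apply: nr'; exists l'.
have [s s1 [bs shs]] := shift_neighbour br' nr'.
have [bn shn] := notch_neighbour gs l i s1.
have E' : x + place i (notch l + s *: basis 0) = x' + place i' (r' + s *: basis 0).
  by rewrite place_id // /place shs addrA E /place; rewrite !addrA; rewrite addrAC.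
have [ii' xx'] := uX _ _ _ _ _ _ Xx Xx' bn bs E'.
case: (nr' l); move: E; rewrite xx' => /addrI E.
suff [] : notch l = r' /\ 0 = shift i' r' by [].
by apply: (box_inj (N := N)) => //; [apply: box_notch | rewrite mul0rn addr0].
Qed.

(** Only downward moves are available, but moving both pieces down by suitable
amounts changes their offset by an arbitrary multiple of N. *)
Lemma piece_rigid i i' x x' : X i x -> X i' x' -> exists w, x' = x + w *+ N.
Proof.
move=> Xx Xx'.
pose P (v : V) := forall i x, X i x -> exists i', X i' (x - v *+ N).
have P0 : P 0 by move=> j y; exists j; rewrite mul0rn subr0.
have PD u v : P u -> P v -> P (u + v).
  move=> Pu Pv j y /Pu[j' /Pv[j'' ?]]; exists j''.
  by rewrite mulrnDl opprD addrA.
have PM u n : P u -> P (u *+ n).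
  by move=> Pu; elim: n => [|n IH]; rewrite ?mulr0n // mulrS; apply: PD.
have Prow (f : 'I_d.+1 -> nat) : P (\row_l (f l)%:Z).
  rewrite [\row_l _]row_sum_delta; apply: big_ind => // l _.
  by rewrite mxE -natz scaler_nat; apply: PM => j y; apply: notch_filled.
have [b [a [ba E]]] := box_euclid (x - x') (period_gt0 k gs).
(* The quotient b is split as u - v with u and v nonnegative. *)
set u : V := \row_l (absz (b 0%R l))%:Z.
set v : V := \row_l (absz (`|b 0 l| - b 0 l)%R)%:Z.
have uv : u - v = b by apply/rowP => l; rewrite !mxE; move: (b 0 l) => c; lia.
have [i1 X1] := Prow (fun l => absz (b 0%R l)) _ _ Xx.
have [i2 X2] := Prow (fun l => absz (`|b 0 l| - b 0 l)%R) _ _ Xx'.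
exists (v - u).
have : x - u *+ N = x' - v *+ N.
  apply: (box_overlap X1 X2); rewrite (_ : _ - _ = a) //.
  have -> : (x - u *+ N) - (x' - v *+ N) = (x - x') - (u - v) *+ N.
    by rewrite opprB mulrnBl opprB [v *+ N - x']addrC addrACA [- _ + v *+ N]addrC.
  by rewrite E uv addrK.
move/eqP; rewrite eq_sym subr_eq => /eqP ->; rewrite mulrnBl.
by rewrite addrAC addrA.
Qed.

Hypothesis X_multiple : forall i x, X i x -> exists w, x = w *+ N.

(** The residue 0 is displaced in no piece, so the piece that covers N w has its
own corner there. *)
Lemma piece_at w : exists i, X i (w *+ N).
Proof.
have [cX _] := tX; have [i [x [r [Xx br]]]] := cX (w *+ N).
have [v xE] := X_multiple Xx; rewrite xE addrCA -mulrnDl -[w *+ N]add0r.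
move=> /(box_inj (box0 k gs) br)[r0 wE]; exists i.
by rewrite add0r wE -r0 shift0 addr0 -xE.
Qed.

Lemma piece_inj i i' x : X i x -> X i' x -> i = i'.
Proof.
have [_ uX] := tX; move=> Xx Xx'.
by have [] := uX _ _ _ _ _ _ Xx Xx' (box0 k gs) (box0 k gs); rewrite // !place_id ?shift0.
Qed.

(** The piece at N w puts its point of residue socket j g into the cube at
w + g, which only a piece with a hole there can accommodate; and its own hole is
filled by the piece at w - g. *)
Lemma kernel_stable (j : 'I_k) g w : g \in gs ->
  X (rshift k j) (w *+ N) ->
  X (rshift k j) ((w + g) *+ N) /\ X (rshift k j) ((w - g) *+ N).
Proof.
have [cX uX] := tX; move=> ging Xw.
have bq := @box_socket d k gs j g ging.
have shq i := shift_socket i j ging.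
split.
  have [i Xi] := piece_at (w + g).
  have [ij|ij] := eqVneq i (rshift k j); first by rewrite -ij.
  have [] := uX _ _ _ _ _ _ Xi Xw bq bq; last by move/eqP: ij.
  rewrite /place !shq eqxx (negbTE ij) mul0rn addr0 mulrnDl.
  by rewrite -addrA [g *+ N + _]addrC.
have [i [x [r [Xx br]]]] := cX (w *+ N + socket gs j g).
have [v xE] := X_multiple Xx; subst x.
rewrite addrCA -mulrnDl [LHS]addrC => E; have [qr] := box_inj bq br E.
rewrite -qr shq; have [ij|ij] := eqVneq i (rshift k j) => wE.
  by rewrite -ij wE addrK.
by move: ij; rewrite (piece_inj Xx (i' := rshift k j)) ?eqxx // -[v]addr0 -wE.
Qed.

End Pieces.

(** * Tilings as unique decompositions *)

Section Tilings.
Variables (G : zmodType) (k : nat).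
Implicit Types F A : 'I_k -> set G.

Lemma TileP F A : Tile F [set: G] A <->
  (forall z, exists j f a, [/\ F j f, A j a & z = f + a]) /\
  (forall j j' f f' a a', F j f -> F j' f' -> A j a -> A j' a' ->
     f + a = f' + a' -> [/\ j = j', f = f' & a = a']).
Proof.
split=> [[dir disj cov]|[cov uniq]].
  split=> [z|j j' f f' a a' Ff Ff' Aa Aa' E].
    have : [set: G] z by [].
    by rewrite -cov => -[j _ [f Ff [a Aa <-]]]; exists j, f, a.
  have jj' : j = j'.
    apply: disj => //; exists (f + a); split; first by exists f => //; exists a.
    by exists f' => //; exists a'.
  subst j'; have [|p [_ p_uniq]] := dir j (f + a).
    by exists f => //; exists a.
  have [pf pa] : (f, a) = (f', a').
    by rewrite -(p_uniq (f, a)) ?(p_uniq (f', a')).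
  by [].
split=> [j c [f Ff [a Aa <-]]|j j' _ _ [c [[f Ff [a Aa <-]] [f' Ff' [a' Aa' E]]]]|].
- exists (f, a); split => //= -[f' a'] /= [Ff' Aa' E].
  by have [_ -> ->] := uniq _ _ _ _ _ _ Ff Ff' Aa Aa' E.
- by have [] := uniq _ _ _ _ _ _ Ff Ff' Aa Aa' (esym E).
- apply/seteqP; split => // z _; have [j [f [a [Ff Aa ->]]]] := cov z.
  by exists j => //; exists f => //; exists a.
Qed.

(** As each tile contains 0, a common element of two translation sets would be
covered twice: their disjointness comes with the tiling. *)
Lemma Tile0P F A : (forall j, F j 0) ->
  Tile0 F [set: G] A <-> Tile F [set: G] A /\ exists j, A j 0.
Proof.
move=> F0; split=> [[tA _ [j _ Aj]]|[tA [j Aj]]]; first by split => //; exists j.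
split=> //; last by exists j.
have [_ uniq] := (TileP F A).1 tA.
move=> i i' _ _ [a [Aa Aa']].
by have [] := uniq _ _ _ _ _ _ (F0 i) (F0 i') Aa Aa' erefl.
Qed.

End Tilings.

(** * Lifting tilings along pi *)

Section Lifting.
Variables (d k : nat) (Gamma : zmodType) (pi : {additive 'rV[int]_d.+1 -> Gamma}).
Hypothesis pi_surj : set_surj [set: 'rV[int]_d.+1] [set: Gamma] pi.
Variable D : set 'rV[int]_d.+1.
Hypothesis hD : fundamental_domain (kernel pi) D.
Variable gs : seq 'rV[int]_d.+1.
Hypothesis gs_kernel : forall g, g \in gs -> kernel pi g.
Hypothesis gs_generate : forall P : set 'rV[int]_d.+1, P 0 ->
  (forall g v, g \in gs -> P v -> P (v + g) /\ P (v - g)) -> kernel pi `<=` P.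

Notation V := 'rV[int]_d.+1.
Notation N := (period k gs).
Notation place := (@place d k gs).
Notation tile := (@tile d k gs).

Variable F : 'I_k -> set Gamma.
Hypothesis F0 : forall j, F j 0.
Implicit Types (j : 'I_k) (y r b : V).

(** The lift of F j to V with 0 lifted to itself, so that pi maps it bijectively
onto F j even if D does not contain 0. *)
Definition base j : set V := [set y | y = 0 \/ (pi @^-1` (F j `\ 0) `&` D) y].

Definition kind j y : 'I_(k + k) := if y == 0 then rshift k j else lshift k j.

Notation lifted := (lifted_tile pi D N tile F).

Lemma period_inj y y' : y *+ N = y' *+ N -> y = y'.
Proof.
by move=> E; have [] // := box_inj (box0 k gs) (box0 k gs) (congr1 (+%R 0) E).
Qed.

(** Equality of two points of pieces determines the residue exactly, but the
positions only modulo the kernel. *)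
Lemma place_fibre i i' r r' y y' :
  box N r -> box N r' -> y *+ N + place i r = y' *+ N + place i' r' ->
  r = r' /\ pi y = pi y'.
Proof.
move=> br br'; rewrite /place addrCA [RHS]addrCA -!mulrnDl => /(box_inj br br')[<-].
move/(congr1 pi); rewrite !raddfD /= (shift_morphism i i' r gs_kernel).
by move/addIr.
Qed.

Lemma base_pi j y : base j y -> F j (pi y).
Proof. by move=> [->|[[Fy _] _]] //; rewrite raddf0. Qed.

Lemma base_lift j f : F j f -> exists y, base j y /\ pi y = f.
Proof.
move=> Ff; have [f0|f0] := pselect (f = 0).
  by exists 0; split; [left | rewrite raddf0].
have [z _ zf] := pi_surj (I : [set: Gamma] f).
have [y [[Dy [l kl ly]] _]] := hD z.
have yf : pi y = f by rewrite -ly raddfD /= kl addr0.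
by exists y; split => //; right; split => //=; rewrite yf; split.
Qed.

Lemma base_inj j y y' : base j y -> base j y' -> pi y = pi y' -> y = y'.
Proof.
move=> [->|[[_ ny] Dy]] [->|[[_ ny'] Dy']] //=; rewrite ?raddf0.
- by move/esym/ny'.
- by move/ny.
move=> E; have [u [_ u_uniq]] := hD y.
rewrite -(u_uniq y) ?(u_uniq y') //; split => //.
  by exists (y' - y); rewrite ?subrKC // /kernel /= raddfB /= E subrr.
by exists 0; rewrite ?addr0 // /kernel /= raddf0.
Qed.

(** Treating the two parts of a lifted tile alike, as pieces indexed by the lift
of F j, turns tilings by lifted tiles into tilings by pieces. *)
Lemma lifted_tileP j f : lifted j f <->
  exists y r, [/\ base j y, box N r & f = y *+ N + place (kind j y) r].
Proof.
split=> [[[_ [y Ly <-] [_ [r br <-] <-]]|[r br <-]]|[y [r [[->|Ly] br ->]]]].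
- exists y, r; split => //; first by right.
  rewrite /kind; case: eqP => // y0; have [[_]] := Ly.
  by rewrite y0 /= raddf0.
- by exists 0, r; split => //; [left | rewrite /kind eqxx mul0rn add0r].
- by right; exists r => //; rewrite /kind eqxx mul0rn add0r.
- left; exists (y *+ N); first by exists y.
  exists (place (kind j y) r) => //; exists r => //.
  rewrite /kind; case: eqP => // y0; have [[_]] := Ly.
  by rewrite y0 /= raddf0.
Qed.

Lemma lifted_direct j : direct (lifted_part pi D N (F j)) (tile (lshift k j)).
Proof.
move=> _ [_ [y Ly <-] [_ [r br <-] <-]].
exists (y *+ N, place (lshift k j) r); split=> /=.
  by split => //; [exists y | exists r].
move=> [_ _] /= [[y' Ly' <-] [r' br' <-]] E.
have [rr' yy'] := place_fibre br br' E.
by subst r'; move: E => /addIr ->.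
Qed.

Lemma lifted_disjoint j :
  sumset (lifted_part pi D N (F j)) (tile (lshift k j)) `&` tile (rshift k j)
    = set0.
Proof.
apply/seteqP; split => // _ [[_ [y Ly <-] [_ [r br <-] <-]] [r' br' /esym E]].
move: E; rewrite -[X in _ = X]add0r -[X in _ = X + _](mul0rn _ N).
move=> /(place_fibre br br')[_ y0].
by have [[_]] := Ly; rewrite /= y0 raddf0.
Qed.

Lemma lifted_tile0 j : lifted j 0.
Proof.
apply/lifted_tileP; exists 0, 0; split; [by left | exact: box0 |].
by rewrite place_id ?shift0 // mul0rn addr0.
Qed.

(** To cover r + N w, decompose pi(w) minus the displacement at r, which pi does
not let depend on the piece, as an element of F j plus one of A j.  The first
fixes the piece, and then its displacement fixes the element of V above the
second. *)
Lemma dilate_preimage_tiling A :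
  Tile0 F [set: Gamma] A ->
  Tile0 lifted [set: V] (fun j => dilate N (pi @^-1` A j)).
Proof.
move=> /(Tile0P _ F0)[/TileP[cov uniq] [j0 Aj0]].
apply/(Tile0P _ lifted_tile0); split; last first.
  by exists j0, 0; rewrite ?mul0rn //= raddf0.
apply/TileP; split=> [z|j j' f f' a a' /lifted_tileP[y [r [By br ->]]]].
  have [w [r [br ->]]] := box_euclid z (period_gt0 k gs).
  pose i0 := rshift k j0.
  have [j [f [a [Ff Aa E]]]] := cov (pi (w - shift gs i0 r)).
  have [y [By yf]] := base_lift Ff.
  pose b := w - y - shift gs (kind j y) r.
  exists j, (y *+ N + place (kind j y) r), (b *+ N); split.
  - by apply/lifted_tileP; exists y, r.
  - exists b => //=; rewrite /b !raddfB /= (shift_morphism _ i0 _ gs_kernel).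
    by rewrite addrAC -raddfB /= E yf addrC addKr.
  - rewrite /place [y *+ N + _]addrCA -addrA -!mulrnDl; congr (_ + _ *+ N).
    by rewrite /b -[w - y - _]addrA -opprD subrKC.
move=> /lifted_tileP[y' [r' [By' br' ->]]] [b Ab <-] [b' Ab' <-].
rewrite addrAC [RHS]addrAC -!mulrnDl => E.
have [rr' pE] := place_fibre br br' E; move: pE; rewrite !raddfD => pE.
have [jj' yy' bb'] := uniq _ _ _ _ _ _ (base_pi By) (base_pi By') Ab Ab' pE.
subst j' r'; have {}yy' := base_inj By By' yy'; subst y'.
split => //; move: E => /addIr/period_inj/addrI -> //.
Qed.

(** The translation set of the j-th lifted tile is the set of positions of the
piece rshift k j.  By rigidity it is N B for some B, and by kernel invariance B
is the preimage of A j = pi(B); the corners of the cubes show that A tiles. *)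
Lemma tiling_dilate_preimage At :
  Tile0 lifted [set: V] At ->
  exists2 A, Tile0 F [set: Gamma] A &
    (fun j => dilate N (pi @^-1` A j)) = At.
Proof.
move=> /(Tile0P _ lifted_tile0)[/TileP[cov uniq] [j0 At0]].
pose X i : set V :=
  [set x | exists j y a, [/\ i = kind j y, base j y, At j a & x = a + y *+ N]].
have tX : piece_tiling gs X.
  split=> [z|i i' x x' r r'].
    have [j [_ [a [/lifted_tileP[y [r [By br ->]]] Aa ->]]]] := cov z.
    exists (kind j y), (a + y *+ N), r; split=> //; first by exists j, y, a.
    by rewrite [LHS]addrC addrA.
  move=> [j [y [a [-> By Aa ->]]]] [j' [y' [a' [-> By' Aa' ->]]]] br br'.
  rewrite -!addrA ![_ + (_ *+ _ + _)]addrC => E.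
  have Lf : lifted j (y *+ N + place (kind j y) r).
    by apply/lifted_tileP; exists y, r.
  have Lf' : lifted j' (y' *+ N + place (kind j' y') r').
    by apply/lifted_tileP; exists y', r'.
  have [jj' ff' aa'] := uniq _ _ _ _ _ _ Lf Lf' Aa Aa' E; subst j' a'.
  have [_ /(base_inj By By') yy'] := place_fibre br br' ff'.
  by rewrite yy'.
have AtX j a : At j a -> X (rshift k j) a.
  by exists j, 0, a; rewrite /kind eqxx mul0rn addr0; split => //; left.
have XAt j a : X (rshift k j) a -> At j a.
  move=> [j' [y [a' [+ By Aa' ->]]]]; rewrite /kind.
  case: eqP => [->|_] /eqP; last by rewrite eq_rlshift.
  by rewrite (inj_eq (@rshift_inj _ _)) mul0rn addr0 => /eqP ->.
have X_multiple i x : X i x -> exists w, x = w *+ N.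
  move=> Xx; have [w ->] := piece_rigid tX (AtX _ _ At0) Xx.
  by exists w; rewrite add0r.
have At_multiple j a : At j a -> exists b, a = b *+ N.
  by move=> /AtX/X_multiple.
have At_kernel j b v : pi v = 0 -> At j (b *+ N) -> At j ((b + v) *+ N).
  move=> kv; move: b.
  apply: (gs_generate (P := [set v | forall b, At j (b *+ N) -> At j ((b + v) *+ N)]))
    => // [b|g u ging Pu]; first by rewrite addr0.
  by split=> b /Pu/AtX/(kernel_stable tX X_multiple ging)[/XAt + /XAt]; rewrite !addrA.
pose A j := pi @` [set b | At j (b *+ N)].
exists A.
  apply/(Tile0P _ F0); split; last first.
    by exists j0, 0; rewrite /= ?mul0rn ?raddf0.
  apply/TileP; split=> [c|j j' f f' a a' Ff Ff' [b Ab <-] [b' Ab' <-]].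
    have [z _ <-] := pi_surj (I : [set: Gamma] c).
    have [i [j [y [a [_ By Aa]]]]] := piece_at tX X_multiple z.
    have [b ab] := At_multiple _ _ Aa; rewrite ab -mulrnDl => /period_inj ->.
    exists j, (pi y), (pi b); split; [exact: base_pi | | by rewrite raddfD addrC].
    by exists b => //=; rewrite -ab.
  (* Two decompositions in Gamma lift to decompositions that differ by a kernel
     element v; kernel invariance lets the second one absorb it. *)
  have [y [By <-]] := base_lift Ff; have [y' [By' <-]] := base_lift Ff'.
  move=> E; pose v := (y + b) - (y' + b').
  have kv : pi v = 0
    by rewrite /v raddfB /= [pi (y + b)]raddfD [pi (y' + b')]raddfD /= E subrr.
  have Ab'v := At_kernel _ _ _ kv Ab'.
  have Ly j1 y1 : base j1 y1 -> lifted j1 (y1 *+ N).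
    move=> By1; apply/lifted_tileP; exists y1, 0; split=> //; first exact: box0.
    by rewrite place_id ?shift0 // addr0.
  have [|jj' yy' bb'] := uniq _ _ _ _ _ _ (Ly _ _ By) (Ly _ _ By') Ab Ab'v.
    by rewrite -!mulrnDl addrA /v subrKC.
  split=> //; first by rewrite (period_inj yy').
  by rewrite (period_inj bb') raddfD /= kv addr0.
apply/funext => j; apply/seteqP; split=> [_ [b [b' Ab' bb'] <-]|a Aa].
  rewrite -[b](subrKC b'); apply: At_kernel => //.
  by rewrite raddfB /= bb' subrr.
by have [b ab] := At_multiple _ _ Aa; exists b; rewrite ?ab //=; exists b; rewrite /= -?ab.
Qed.

End Lifting.

Theorem theorem1p1 (d k : nat) (hd : (0 < d)%N) (hk : (0 < k)%N)
    (Gamma : zmodType) (pi : {additive 'rV[int]_d -> Gamma})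
    (hpi : set_surj [set: 'rV[int]_d] [set: Gamma] pi)
    (D : set 'rV[int]_d) (hD : fundamental_domain (kernel pi) D) :
  exists N : nat, (0 < N)%N /\
  exists T : 'I_(k + k) -> set 'rV[int]_d,
    (forall i, finite_set (T i)) /\
    forall F : 'I_k -> set Gamma,
      (forall j, finite_set (F j)) ->
      (forall j, F j 0) ->
      (forall j,
         direct (lifted_part pi D N (F j)) (T (lshift k j)) /\
         sumset (lifted_part pi D N (F j)) (T (lshift k j))
           `&` T (rshift k j) = set0) /\
      Tile0 (lifted_tile pi D N T F) [set: 'rV[int]_d] =
        lifted_tilings pi N (Tile0 F [set: Gamma]).
Proof.
case: d hd pi hpi D hD => // d _ pi hpi D hD.
have [gs [gs_kernel gs_generate]] : exists gs : seq 'rV[int]_d.+1,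
    (forall g, g \in gs -> kernel pi g) /\
    forall P : set 'rV[int]_d.+1, P 0 ->
      (forall g v, g \in gs -> P v -> P (v + g) /\ P (v - g)) ->
      kernel pi `<=` P.
  apply: subgroup_finite_generators; rewrite /kernel /= ?raddf0 // => u v.
  by rewrite raddfB /= => -> ->; rewrite subrr.
exists (period k gs); split; first exact: period_gt0.
exists (@tile d k gs); split=> [i|F _ F0]; first exact/finite_image/finite_box.
split=> [j|]; first by split; [apply: lifted_direct | apply: lifted_disjoint].
apply/seteqP; split=> [At tA|_ [A tA <-]]; last exact: dilate_preimage_tiling.
have [A tA' <-] := tiling_dilate_preimage hpi hD gs_kernel gs_generate F0 tA.
by exists A.
Qed.
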